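(* (I) For any $f\in\mathcal F_{1,2}\setminus\{0\}$, any integer $n\ge2$, and any v-martingale $(S_j)_{j=1}^n$ with differences $X_1,\dots,X_n$, $$\mathsf E f(S_n)\le \mathsf E f(X_1)+C\sum_{j=2}^n\mathsf E f(X_j)\qquad( * )$$ with $C=C_f$, where $$C_f:=\sup_{0<x<s<\infty}\frac{L_{f;s}(x)}{f(s)},\qquad L_{f;s}(x):=f(x-s)-f(x)+s f'(x).$$ (II) The constant factor $C_f$ is the best possible in the sense that, for each $f\in\mathcal F_{1,2}\setminus\{0\}$ and each integer $n\ge2$, the number $C_f$ is the smallest value of $C$ such that inequality $( * )$ holds for all v-martingales $(S_j)_{j=1}^n$; in fact, $C_f$ is the best possible even if the differences $X_1,\dots,X_n$ are assumed to be any independent zero-mean random variables (that is, for each such $f$ and $n$, $C_f$ is also the smallest $C$ such that $( * )$ holds whenever $X_1,\dots,X_n$ are independent zero-mean random variables and $S_n=X_1+\dots+X_n$). (III) For each $f\in\mathcal F_{1,2}\setminus\{0\}$, $1\le C_f\le 2$. (IV) For each $C\in[1,2]$ there is some $f\in\mathcal F_{1,2}\setminus\{0\}$ such that $C_f=C$; in particular, the bounds $1$ and $2$ on $C_f$ in (III) are the best possible ones.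
   Context: $\mathcal F_{1,2}$ is the class of all continuously differentiable functions $f:\mathbb R\to\mathbb R$ such that $f(0)=0$, $f$ is even, and $f'$ is nondecreasing and concave on $[0,\infty)$. Every $f\in\mathcal F_{1,2}$ is convex and nonnegative, and $f>0$ on $\mathbb R\setminus\{0\}$ if $f\in\mathcal F_{1,2}\setminus\{0\}$. For a finite sequence $(S_j)_{j=1}^n$ of real-valued random variables, the differences are $X_j:=S_j-S_{j-1}$ for $j=1,\dots,n$, with $S_0:=0$ (so $X_1=S_1$). The sequence $(S_j)_{j=1}^n$ is called a v-martingale if $\mathsf E|X_j|<\infty$ and $\mathsf E(X_j\mid S_{j-1})=0$ for all $j=2,\dots,n$; no condition is imposed on $X_1$. Expectations of nonnegative random variables may equal $+\infty$. *)

(* Defs.v *)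
From HB Require Import structures.
From mathcomp Require Import all_boot all_order all_algebra.
From mathcomp Require Import finmap.
From mathcomp Require Import all_classical all_reals all_analysis.

Set Implicit Arguments.
Unset Strict Implicit.
Unset Printing Implicit Defensive.

Import Order.TTheory GRing.Theory Num.Theory.
Import numFieldNormedType.Exports.

Local Open Scope ring_scope.
Local Open Scope classical_set_scope.

Section function_class.
Context {R : realType}.
Implicit Types (f : R -> R).

Definition F12 f : Prop :=
  [/\ (forall x, derivable f x 1) /\ continuous f^`(),
      f 0 = 0,
      forall x, f (- x) = f x,
      {in `[0, +oo[ &, {homo f^`() : x y / x <= y}} &
      (* concavity of f^`() on [0, +oo[ *)
      convex_function (`[0, +oo[%classic : set R) (fun x => - (f^`())%classic x)].

Definition F12_nonzero f : Prop := F12 f /\ f <> cst 0.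

Definition Lfs f (s x : R) : R := f (x - s) - f x + s * (f^`())%classic x.

(* The supremum is taken in \bar R, so that it is the genuine supremum whether
   or not the set is bounded. *)
Definition Cf f : \bar R :=
  ereal_sup [set r | exists x s : R, 0 < x < s /\ r = (Lfs f s x / f s)%:E].

End function_class.

Section probability_notions.
Context d (T : measurableType d) {R : realType} (P : probability T R).
Local Open Scope ereal_scope.

(* Z is a version of E(X | Y), the conditional expectation of X given the
   sigma-algebra generated by Y *)
Definition is_cond_expectation (X Y Z : T -> R) : Prop :=
  [/\ P.-integrable setT (EFin \o Z),
      forall B : set R, measurable B ->
        g_sigma_algebra_preimage Y (Z @^-1` B) &
      forall A : set T, g_sigma_algebra_preimage Y A ->
        \int[P]_(w in A) (X w)%:E = \int[P]_(w in A) (Z w)%:E].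

Definition independent_RVs (I : set nat) (X : nat -> {RV P >-> R}) : Prop :=
  forall (J : {fset nat}) (B : nat -> set R),
    [set` J] `<=` I -> (forall j, j \in J -> measurable (B j)) ->
    P (\bigcap_(j in [set` J]) (X j @^-1` B j)) =
    \prod_(j <- J) P (X j @^-1` B j).

(* A finite sequence indexed by 1..n is the restriction to these indices of a
   sequence indexed by nat; no other term of S is ever used, since
   S_0 is taken to be 0 whatever the value of S 0. *)
Definition with_S0 (S : nat -> {RV P >-> R}) (j : nat) : T -> R :=
  if j is 0%N then cst 0%R else S j.

Definition differences (S : nat -> {RV P >-> R}) (j : nat) : T -> R :=
  fun w => (with_S0 S j w - with_S0 S j.-1 w)%R.

Definition v_martingale (n : nat) (S : nat -> {RV P >-> R}) : Prop :=
  forall j : nat, (2 <= j <= n)%N ->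
    P.-integrable setT (EFin \o differences S j) /\
    is_cond_expectation (differences S j) (with_S0 S j.-1) (cst 0%R).

Definition independent_zero_mean (n : nat) (X : nat -> {RV P >-> R}) : Prop :=
  independent_RVs [set j | (1 <= j <= n)%N] X /\
  forall j : nat, (1 <= j <= n)%N ->
    P.-integrable setT (EFin \o X j) /\ 'E_P[X j] = 0.

Definition moment_bound (f : R -> R) (n : nat) (C : \bar R)
    (Sn : T -> R) (X : nat -> T -> R) : Prop :=
  'E_P[f \o Sn] <=
  'E_P[f \o X 1%N] + C * \sum_(2 <= j < n.+1) 'E_P[f \o X j].

End probability_notions.

Section admissible_constants.
Context {R : realType}.
Implicit Types (f : R -> R) (n : nat).

Definition v_martingale_constants f n : set (\bar R) :=
  [set C | forall d (T : measurableType d) (P : probability T R)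
             (S : nat -> {RV P >-> R}),
     v_martingale n S -> moment_bound P f n C (S n) (differences S)].

Definition independent_constants f n : set (\bar R) :=
  [set C | forall d (T : measurableType d) (P : probability T R)
             (X : nat -> {RV P >-> R}),
     independent_zero_mean n X ->
     moment_bound P f n C (fun w => \sum_(1 <= j < n.+1) X j w) X].

Definition is_smallest (A : set (\bar R)) (c : \bar R) : Prop :=
  A c /\ lbound A c.

End admissible_constants.

(* Main.v *)
From HB Require Import structures.
Require Import Defs.
From mathcomp Require Import all_boot all_order all_algebra.
From mathcomp Require Import finmap.
From mathcomp Require Import all_classical all_reals all_analysis.
From mathcomp Require Import measurable_realfun.
From mathcomp Require Import ring lra.

(** Why the theorem is true.

    Write [g] for the derivative of [f], an odd function which is nondecreasing,
    and concave with [g 0 = 0] on the half-line; it is thus subadditive there.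

    The upper bound rests on one deterministic inequality, [F12_upper_tangent]:
    [f (x + t) <= f x + t * g x + Cf f * f t] for all real [x] and [t].
    If [t] moves [x >= 0] away from [0], or towards [0] without crossing it,
    subadditivity of [g] gives it with the constant [1], which is at most
    [Cf f]; if [t] crosses [0], it is the definition of [Cf f].
    Put [x = S_(j-1)] and [t = X_j] and take expectations: the linear term
    [X_j * g S_(j-1)] has mean [0] because [X_j] has conditional mean [0] given
    [S_(j-1)]. As this product need not be integrable, the inequality is
    integrated over the level sets of a discretization of [g S_(j-1)]
    ([integral_le_cond_mean0]); induction on the number of steps concludes.
    Independent zero-mean summands are a special case, since a partial sum is
    independent of the next summand ([independent_v_martingale]).

    For sharpness, two nonzero independent summands suffice. The first one is
    [x] except for a far atom [- y] of small probability that restores mean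
    zero; the second is [- s] with small probability and a small [dl > 0]
    otherwise. By convexity the atom [- y] contributes with the right sign.
    As [y] grows and then [dl] vanishes, the moment bound with constant [c]
    becomes [Lfs f s x <= c * f s] ([Lfs_le_independent_constants]).

    That [1 <= Cf f] is seen at [x] near [0], where [Lfs f s x] tends to [f s].
    That [Cf f <= 2] follows from [s * g s <= 2 * f s] when [x >= s / 2], and
    from tangent lines when [x < s / 2].

    Every constant in [[1, 2]] is realized by a function whose derivative has
    slope [1] up to [1] and slope [1 - k] beyond. The worst [x] is then [1], and
    the remaining maximum over [s] is that of a quotient of quadratics. Solving
    for [k] the equation saying that this maximum is [1 + t] gives
    [k = t * (3 - t) / (1 + t)], with maximum at [s = (3 - t) / (1 - t)];
    for [t = 1] it becomes a supremum approached as [s] grows ([Cf_bent]). *)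

Set Implicit Arguments.
Unset Strict Implicit.
Unset Printing Implicit Defensive.

Import Order.TTheory GRing.Theory Num.Theory.
Import numFieldNormedType.Exports.

Local Open Scope ring_scope.
Local Open Scope classical_set_scope.

(** * Functions whose derivative is nondecreasing and concave *)

Section derive_tools.
Context {R : realType}.
Implicit Types (F dF : R -> R).

Lemma ler_of_is_derive F dF (a b : R) : a <= b ->
  (forall x : R, is_derive x 1 F (dF x)) ->
  (forall x, a <= x <= b -> 0 <= dF x) -> F a <= F b.
Proof.
move=> ab dFE dF0.
have cF : {within `[a, b], continuous F}.
  apply: continuous_subspaceT => x; apply: differentiable_continuous.
  by apply/derivable1_diffP; have [] := dFE x.
have [c] := MVT_segment ab (fun x _ => dFE x) cF.
rewrite in_itv /= => /dF0 c0 FE.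
by rewrite -subr_ge0 FE mulr_ge0// subr_ge0.
Qed.

Lemma is_derive_affine F dF (a b x : R) :
  (forall y : R, is_derive y 1 F (dF y)) ->
  is_derive x 1 (fun u => F (a + b * u)) (b * dF (a + b * x)).
Proof.
move=> FE.
have H : is_derive x 1 (fun u : R => a + b * u) b.
  by apply: is_derive_eq; rewrite add0r mul1r [LHS]mulr1.
have := @is_derive1_comp _ F (fun u : R => a + b * u) x _ _ (FE _) H.
by rewrite mulrC.
Qed.

End derive_tools.

Section F12_theory.
Context {R : realType} (f : R -> R) (Ff : F12 f).
Local Notation g := (f^`()%classic).
Implicit Types s t u x y : R.

Lemma F12_is_derive (x : R) : is_derive x 1 f (g x).
Proof. by have [[df _] _ _ _ _] := Ff; rewrite derive1E; apply/derivableP. Qed.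

Lemma F12_continuous : continuous f.
Proof.
have [[df _] _ _ _ _] := Ff.
by move=> x; apply: differentiable_continuous; apply/derivable1_diffP.
Qed.

Lemma F12_deriveN x : g (- x) = - g x.
Proof.
have [_ _ ef _ _] := Ff.
have := @is_derive_affine _ _ _ 0 (-1) x F12_is_derive.
rewrite (_ : (fun u => _) = f); last first.
  by apply/funext => u; rewrite add0r mulN1r ef.
rewrite add0r !mulN1r => H.
have [_ e1] := H; have [_ e2] := F12_is_derive x.
by rewrite -e2 e1 opprK.
Qed.

Lemma F12_derive0 : g 0 = 0.
Proof. by have := F12_deriveN 0; rewrite oppr0 => H; lra. Qed.

Lemma F12_derive_homo_ge0 x y : 0 <= x -> x <= y -> g x <= g y.
Proof.
move=> x0 xy; have [_ _ _ h _] := Ff.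
by have := h x y; rewrite !inE /= !in_itv /= !andbT; apply=> //; exact: le_trans xy.
Qed.

Lemma F12_derive_ge0 x : 0 <= x -> 0 <= g x.
Proof. by move=> x0; rewrite -F12_derive0 F12_derive_homo_ge0. Qed.

Lemma F12_derive_homo x y : x <= y -> g x <= g y.
Proof.
move=> xy; have [x0|x0] := leP 0 x; first exact: F12_derive_homo_ge0.
have [y0|y0] := leP 0 y.
  apply: (@le_trans _ _ 0); last exact: F12_derive_ge0.
  by rewrite -[x]opprK F12_deriveN oppr_le0 F12_derive_ge0// oppr_ge0 ltW.
rewrite -[x]opprK -[y]opprK !(F12_deriveN (- _)) lerN2 F12_derive_homo_ge0//.
  by rewrite oppr_ge0 ltW.
by rewrite lerN2.
Qed.

Lemma F12_derive_scale t x : 0 <= t <= 1 -> 0 <= x -> t * g x <= g (t * x).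
Proof.
move=> /andP[t0 t1] x0; have [_ _ _ _ cf] := Ff.
have := cf (Itv01 t0 t1) x 0.
rewrite !inE /= !in_itv /= !andbT lexx x0 => /(_ isT isT).
rewrite !convRE /= F12_derive0 oppr0 mulr0 addr0.
have -> : conv (Itv01 t0 t1) (x : convex_lmodType R^o) 0 = t * x.
  by rewrite /conv /= scaler0 addr0.
by rewrite mulrN lerN2.
Qed.

(** Both [x] and [y] lie in [[0, x + y]], where the derivative is above its chord
    from [0]; the two chord values add up to [g (x + y)]. *)
Lemma F12_derive_subadd x y : 0 <= x -> 0 <= y -> g (x + y) <= g x + g y.
Proof.
move=> x0 y0; have [->|xy0] := eqVneq (x + y) 0.
  by rewrite F12_derive0 addr_ge0 ?F12_derive_ge0.
have xyp : 0 < x + y by rewrite lt_def xy0 addr_ge0.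
have sc z : 0 <= z <= x + y -> z / (x + y) * g (x + y) <= g z.
  move=> /andP[z0 zxy].
  have -> : g z = g (z / (x + y) * (x + y)) by rewrite mulfVK.
  by apply: F12_derive_scale; rewrite ?(ltW xyp)// divr_ge0 ?(ltW xyp)//=
     ler_pdivrMr// mul1r.
have hx := sc x; have hy := sc y.
have -> : g (x + y) = x / (x + y) * g (x + y) + y / (x + y) * g (x + y).
  by rewrite -mulrDl -mulrDl divff// mul1r.
by apply: lerD; [apply: hx|apply: hy]; rewrite ?x0 ?y0 ?lerDl ?lerDr.
Qed.

(** Convexity of [f], as the position of its tangent lines. *)
Lemma F12_tangent x t : f x + t * g x <= f (x + t).
Proof.
pose F (u : R) := f (x + t * u) - u * (t * g x).
have dF (u : R) : is_derive u 1 F (t * g (x + t * u) - t * g x).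
  have := @is_derive_affine _ _ _ x t u F12_is_derive => H.
  by apply: is_derive_eq; rewrite scaler0 add0r [X in _ - X]mulr1.
have /(_ ler01) := @ler_of_is_derive _ F _ 0 1 _ dF.
rewrite /F !mulr0 !mulr1 addr0 mul0r subr0 mul1r lerBrDr => -> //.
move=> u /andP[u0 u1]; rewrite -mulrBr.
have [t0|t0] := leP 0 t.
  by rewrite mulr_ge0// subr_ge0 F12_derive_homo// lerDl mulr_ge0.
have {}t0 := ltW t0.
by rewrite mulr_le0// subr_le0 F12_derive_homo// gerDl mulr_le0_ge0.
Qed.

Lemma F12_ge0 x : 0 <= f x.
Proof.
have [_ f0 _ _ _] := Ff.
by have := F12_tangent 0 x; rewrite f0 F12_derive0 !add0r mulr0.
Qed.

Lemma F12_homo x y : 0 <= x -> x <= y -> f x <= f y.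
Proof.
move=> x0 xy; have := F12_tangent x (y - x); rewrite subrKC.
by apply: le_trans; rewrite lerDl mulr_ge0 ?F12_derive_ge0// subr_ge0.
Qed.

(** A concave derivative vanishing at [0] lies above its chord from [0] to
    [s], so the area below it is at least that of a triangle. *)
Lemma F12_triangle s : 0 <= s -> s * g s <= 2 * f s.
Proof.
have [_ f0 _ _ _] := Ff.
move=> s0; pose F (u : R) := 2 * f (s * u) - u * u * (s * g s).
have dF (u : R) : is_derive u 1 F (2 * (s * (g (s * u) - u * g s))).
  have := @is_derive_affine _ _ _ 0 s u F12_is_derive => H.
  rewrite (_ : F = fun u => 2 * f (0 + s * u) - u * u * (s * g s)); last first.
    by apply/funext => v; rewrite add0r.
  by apply: is_derive_eq; rewrite !scaler0 !add0r; rewrite /GRing.scale /=; ring.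
have /(_ ler01) := @ler_of_is_derive _ F _ 0 1 _ dF.
rewrite /F !mulr0 !mulr1 !mul0r subr0 mul1r f0 mulr0 subr_ge0; apply.
move=> u u01; rewrite !mulr_ge0// subr_ge0 mulrC (mulrC s).
by rewrite mulrC F12_derive_scale.
Qed.

Context (fn0 : f <> cst 0).

(** If [f s = 0], then [g s = 0] by [F12_triangle]; concavity and
    monotonicity then make [g], hence [f], vanish identically. *)
Lemma F12_gt0 s : 0 < s -> 0 < f s.
Proof.
have [_ f0 fe _ _] := Ff.
move=> s0; rewrite lt_def F12_ge0 andbT; apply/eqP => fs0; apply: fn0.
have gs0 : g s = 0.
  apply/eqP; rewrite eq_le F12_derive_ge0 ?(ltW s0)// andbT.
  have := F12_triangle (ltW s0); rewrite fs0 mulr0.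
  by rewrite pmulr_rle0.
have ge0 u : 0 <= u -> g u = 0.
  move=> u0; apply/eqP; rewrite eq_le F12_derive_ge0// andbT.
  have [us|su] := leP u s; first by rewrite -gs0 F12_derive_homo.
  have up := lt_trans s0 su.
  have su01 : 0 <= s / u <= 1.
    by rewrite divr_ge0 ?(ltW s0)//= ler_pdivrMr// mul1r ltW.
  have := F12_derive_scale su01 u0.
  by rewrite mulfVK ?gt_eqF// gs0 pmulr_rle0// divr_gt0.
have fp u : 0 <= u -> f u = 0.
  move=> u0; apply/eqP; rewrite eq_le F12_ge0 andbT.
  by rewrite (le_trans _ (_ : 0 <= 0))//; have := F12_triangle u0;
    have := F12_tangent u (- u); rewrite subrr f0 ge0// !mulr0 addr0.
apply/funext => u /=; have [u0|u0] := leP 0 u; first exact: fp.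
by rewrite -fe fp// oppr_ge0 ltW.
Qed.

(** With [t = - s], the bound says that [g (x + u) - g x] has a smaller integral
    over [[0, t]] than [g u], which is subadditivity of [g]. *)
Lemma Lfs_le_left s x : 0 <= x -> s <= 0 -> Lfs f s x <= f s.
Proof.
have [_ f0 fe _ _] := Ff.
move=> x0 s0; have : 0 <= - s by rewrite oppr_ge0.
rewrite -[s in Lfs _ s]opprK -[f s]fe; move: (- s) => {s0} t t0.
rewrite /Lfs opprK.
pose F (u : R) := f (0 + 1 * u) - f (x + 1 * u) + u * g x.
have dF (u : R) : is_derive u 1 F (g u - g (x + u) + g x).
  have H1 := @is_derive_affine _ _ _ 0 1 u F12_is_derive.
  have H2 := @is_derive_affine _ _ _ x 1 u F12_is_derive.
  by apply: is_derive_eq; rewrite !scaler0 !add0r !mul1r [_ *: _]mulr1.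
have /(_ t0) := @ler_of_is_derive _ F _ 0 t _ dF.
rewrite /F !mulr0 !add0r !addr0 !mul1r mul0r f0.
move=> H; suff : 0 - f x + 0 <= f t - f (x + t) + t * g x by lra.
apply: H => u /andP[u0 ut]; have := F12_derive_subadd x0 u0; lra.
Qed.

(** Same comparison, between [g x - g (x - u)] and [g u]. *)
Lemma Lfs_le_mid s x : 0 <= s <= x -> Lfs f s x <= f s.
Proof.
have [_ f0 fe _ _] := Ff.
move=> /andP[s0 sx]; rewrite /Lfs.
pose F (u : R) := f (0 + 1 * u) - f (x + (-1) * u) - u * g x.
have dF (u : R) : is_derive u 1 F (g u + g (x - u) - g x).
  have H1 := @is_derive_affine _ _ _ 0 1 u F12_is_derive.
  have H2 := @is_derive_affine _ _ _ x (-1) u F12_is_derive.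
  by apply: is_derive_eq; rewrite !scaler0 !add0r !mul1r [_ *: _]mulr1 !mulN1r opprK.
have /(_ s0) := @ler_of_is_derive _ F _ 0 s _ dF.
rewrite /F !mulr0 !add0r !addr0 !mul1r mul0r f0 mulN1r.
move=> H; suff : 0 - f x - 0 <= f s - f (x - s) - s * g x by lra.
apply: H => u /andP[u0 us].
have xu : 0 <= x - u by rewrite subr_ge0 (le_trans us).
have := F12_derive_subadd u0 xu; rewrite subrKC; lra.
Qed.

(** When [s - x <= x], the difference [f (x - s) - f x] is nonpositive and
    [s * g x <= s * g s <= 2 * f s]. Otherwise [f s] is compared with the
    tangents at [x] and at [s - x], both of slope at least [g x]. *)
Lemma Lfs_le2 s x : 0 < x < s -> Lfs f s x <= 2 * f s.
Proof.
have [_ f0 fe _ _] := Ff.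
move=> /andP[x0 xs]; rewrite /Lfs -[f (x - s)]fe opprB.
have s0 := lt_trans x0 xs.
have tri := F12_triangle (ltW s0).
have [h|h] := leP (s - x) x.
  have := @F12_homo (s - x) x; rewrite subr_ge0 ltW// => /(_ isT h) H.
  have : s * g x <= s * g s by rewrite ler_wpM2l ?(ltW s0)// F12_derive_homo ?ltW.
  lra.
have h1 := F12_tangent (s - x) x; rewrite subrK in h1.
have h2 := F12_tangent x (s - x); rewrite subrKC in h2.
have h3 : x * g x <= x * g (s - x) by rewrite ler_wpM2l ?(ltW x0)// F12_derive_homo ?ltW.
have := F12_ge0 x; rewrite mulrBl in h2; lra.
Qed.

Lemma Cf_ge s x : 0 < x < s -> ((Lfs f s x / f s)%:E <= Cf f)%E.
Proof. by move=> xs; apply: ereal_sup_ubound; exists x, s. Qed.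

Lemma Cf_le2 : (Cf f <= 2%:E)%E.
Proof.
apply: ge_ereal_sup => _ [x [s [xs ->]]]; rewrite lee_fin ler_pdivrMr.
  exact: Lfs_le2.
by apply: F12_gt0; move: xs => /andP[]; exact: lt_trans.
Qed.

(** As [x] decreases to [0], [Lfs f 1 x] tends to [f (- 1) = f 1]. *)
Lemma Cf_ge1 : (1%:E <= Cf f)%E.
Proof.
have [[_ cg] f0 fe _ _] := Ff.
have f1 := F12_gt0 ltr01.
have cf := F12_continuous.
have cv : (fun x => (Lfs f 1 x / f 1)%:E) x @[x --> 0^'+] --> 1%:E.
  apply: cvg_EFin; first by near=> x.
  rewrite /comp /=.
  rewrite [X in _ --> X](_ : _ = (f (0 - 1) - f 0 + 1 * g 0) / f 1); last first.
    by rewrite f0 subr0 F12_derive0 mulr0 addr0 add0r fe divff// gt_eqF.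
  apply: cvgM; last exact: cvg_cst.
  apply: cvgD; last first.
    by apply: cvgM; [exact: cvg_cst|apply: cvg_at_right_filter; exact: cg].
  apply: cvgB; last by apply: cvg_at_right_filter; exact: cf.
  apply: (@cvg_at_right_filter _ _ (fun x => f (x - 1))).
  apply: (@continuous_comp _ _ _ (fun x : R => x - 1) f); last exact: cf.
  by apply: cvgB; [exact: cvg_id|exact: cvg_cst].
apply: (cvge_to_le cv).
near=> x.
apply: Cf_ge; apply/andP; split; near: x; [exact: nbhs_right_gt|exact: nbhs_right_lt].
Unshelve. all: by end_near. Qed.

Lemma Cf_fin : Cf f = (fine (Cf f))%:E.
Proof.
rewrite fineK// fin_numE; apply/andP; split; apply/eqP => E.
  by have := Cf_ge1; rewrite E.
by have := Cf_le2; rewrite E.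
Qed.

(** By symmetry [x >= 0]. With [s = - t], [Lfs_le_left] and [Lfs_le_mid] treat
    the increments that do not carry [x] across [0], with the constant
    [1 <= Cf f]; the other ones enter the supremum [Cf f], except that [x = 0]
    is trivial. *)
Lemma F12_upper_tangent x t : f (x + t) <= f x + t * g x + fine (Cf f) * f t.
Proof.
have [_ f0 fe _ _] := Ff.
set C := fine _.
have C1 : 1 <= C by have := Cf_ge1; rewrite Cf_fin lee_fin.
suff main s y : 0 <= y -> Lfs f s y <= C * f s.
  have [x0|x0] := leP 0 x.
    have := main (- t) _ x0; rewrite /Lfs opprK fe mulNr; lra.
  have /(main t) : 0 <= - x by rewrite oppr_ge0 ltW.
  rewrite /Lfs -opprD !fe F12_deriveN mulrN; lra.
move=> y0.
have w : Lfs f s y <= f s -> Lfs f s y <= C * f s.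
  by move/le_trans; apply; rewrite ler_peMl// F12_ge0.
have [s0|s0] := leP s 0; first exact/w/Lfs_le_left.
have [sy|ys] := leP s y; first by apply/w/Lfs_le_mid; rewrite ltW.
have [->|yn0] := eqVneq y 0.
  rewrite /Lfs f0 F12_derive0 mulr0 subr0 addr0 sub0r fe.
  by rewrite ler_peMl// F12_ge0.
have yp : 0 < y by rewrite lt_def yn0.
have := @Cf_ge s y; rewrite yp ys Cf_fin lee_fin => /(_ isT).
by rewrite ler_pdivrMr// F12_gt0.
Qed.

End F12_theory.

(** * The moment bound for v-martingales *)

Section v_martingale_step.
Context d (T : measurableType d) {R : realType} (P : probability T R).

(** The integer value of [floor] is encoded as a natural number, so that the
    fibers form a sequence. *)
Lemma measurable_floor_fiber (h : R -> R) (n : nat) :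
  measurable_fun setT h ->
  measurable ((fun x => choice.pickle (Num.floor (h x))) @^-1` [set n]).
Proof.
move=> mh; have [[z zn]|nz] := pselect (exists z : int, choice.pickle z = n).
  rewrite (_ : _ @^-1` _ = setT `&` h @^-1` `[z%:~R, (z + 1)%:~R[%classic).
    exact: mh.
  apply/seteqP; split=> x /=.
    rewrite -zn => /(pcan_inj choice.pickleK) <-; split=> //.
    by rewrite in_itv /= floor_itv.
  by rewrite in_itv /= => -[_ /floor_def ->].
rewrite (_ : _ @^-1` _ = set0) //; apply/seteqP; split=> x //= xn.
by apply: nz; exists (Num.floor (h x)).
Qed.

(** On each level set of [floor (g Y / e)], the factor [g Y]
    is within [e] of a constant, and multiplying by a constant keeps the
    conditional mean of [X] equal to zero. Summing over the countably many level
    sets costs at most [e * E |X|], so no integrability of [X * g Y] is needed. *)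
Lemma integral_le_cond_mean0 (g : R -> R) (U V X Y : T -> R) :
  measurable_fun setT g -> measurable_fun setT U -> measurable_fun setT V ->
  measurable_fun setT Y ->
  P.-integrable setT (EFin \o X) ->
  (forall A, g_sigma_algebra_preimage Y A -> (\int[P]_(w in A) (X w)%:E = 0)%E) ->
  (forall w, 0 <= U w) -> (forall w, 0 <= V w) ->
  (forall w, U w <= V w + X w * g (Y w)) ->
  (\int[P]_w (U w)%:E <= \int[P]_w (V w)%:E)%E.
Proof.
move=> mg mU mV mY iX X0 U0 V0 UV.
have mX : measurable_fun setT X by exact/measurable_EFinP/(measurable_int _ iX).
have iVge0 : (0 <= \int[P]_w (V w)%:E)%E.
  by apply: integral_ge0 => w _; rewrite lee_fin.
have [Vy|/eqP Vny] := eqVneq (\int[P]_w (V w)%:E)%E +oo%E.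
  by rewrite Vy leey.
have iV : P.-integrable setT (EFin \o V).
  apply/integrableP; split; first exact/measurable_EFinP.
  under eq_integral do rewrite /= ger0_norm//.
  by rewrite ltey; apply/eqP.
have iaX : P.-integrable setT (fun w => `|X w|%:E).
  exact: (integrable_abse iX).
suff step (e : R) : 0 < e ->
    (\int[P]_w (U w)%:E <= \int[P]_w (V w)%:E + e%:E * \int[P]_w `|X w|%:E)%E.
  have [r r0 rE] : exists2 r, 0 <= r & (\int[P]_w `|X w|%:E = r%:E)%E.
    have : (0 <= \int[P]_w `|X w|%:E)%E by apply: integral_ge0.
    move=> /gee0P[Xy|//].
    move: iaX => /integrableP[_]; under eq_integral do rewrite /= normr_id.
    by rewrite Xy.
  apply/lee_addgt0Pr => e e0.
  have r1 : 0 < r + 1 by rewrite ltr_wpDl.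
  have /step/le_trans : 0 < e / (r + 1) by rewrite divr_gt0.
  apply; rewrite leeD2l// rE -EFinM lee_fin mulrAC ler_pdivrMr//.
  by rewrite ler_pM2l// lerDl.
move=> e0.
pose p x := choice.pickle (Num.floor (g x / e)).
pose B (n : nat) := (p \o Y) @^-1` [set n].
have mge : measurable_fun setT (fun x => g x / e) by exact: measurable_funM.
have sB n : g_sigma_algebra_preimage Y (B n).
  by exists (p @^-1` [set n]); [exact: measurable_floor_fiber|rewrite setTI].
have mB n : measurable (B n).
  rewrite /B comp_preimage -[X in measurable X]setTI; apply: mY => //.
  exact: measurable_floor_fiber.
have tB : trivIset setT B by exact: trivIset_preimage1.
have BT : \bigcup_n B n = setT.
  by apply/seteqP; split=> // w _; exists (p (Y w)).
have W0 w : 0 <= V w + e * `|X w| by rewrite addr_ge0// mulr_ge0// ltW.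
have mW : measurable_fun setT (fun w => V w + e * `|X w|).
  apply: measurable_funD => //; apply: measurable_funM => //.
  exact: measurableT_comp.
have iW : P.-integrable setT (fun w => (V w + e * `|X w|)%:E).
  under eq_fun do rewrite EFinD EFinM.
  by apply: integrableD => //; exact: integrableZl.
rewrite -ge0_integralZl//; last 2 first.
  by apply/measurable_EFinP; exact: measurableT_comp.
  by rewrite lee_fin ltW.
rewrite -ge0_integralD//; last 4 first.
  by move=> w _; rewrite lee_fin.
  exact/measurable_EFinP.
  by move=> w _; rewrite -EFinM lee_fin mulr_ge0// ltW.
  apply/measurable_EFinP; apply: measurable_funM => //; exact: measurableT_comp.
under [leRHS]eq_integral do rewrite -EFinM -EFinD.
rewrite -BT ge0_integral_bigcup//; last 2 first.
  by rewrite BT; exact/measurable_EFinP.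
  by move=> w _; rewrite lee_fin.
rewrite ge0_integral_bigcup//; last 2 first.
  by rewrite BT; exact/measurable_EFinP.
  by move=> w _; rewrite lee_fin.
apply: lee_nneseries => [n _ _|n _].
  by apply: integral_ge0 => w _; rewrite lee_fin.
(* The constant value of [e * floor (g Y / e)] on [B n]; an [n] which encodes no
   integer has an empty [B n], and gets the default value [0]. *)
pose c : R := e * (odflt 0 (choice.unpickle n : option int))%:~R.
have cB w : B n w -> `|g (Y w) - c| <= e.
  move=> Bw; have {Bw} : p (Y w) = n by [].
  rewrite /c => <-; rewrite /p choice.pickleK /=.
  have /andP[h1 h2] := floor_itv (g (Y w) / e).
  rewrite ler_pdivlMr// in h1; rewrite ltr_pdivrMr// intrD mulrDl mul1r in h2.
  by rewrite mulrC ger0_norm ?subr_ge0// lerBlDl ltW.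
have iXB : P.-integrable (B n) (EFin \o X) by exact: integrableS iX.
have iWB : P.-integrable (B n) (fun w => (V w + e * `|X w|)%:E).
  exact: integrableS iW.
apply: (@le_trans _ _
  (\int[P]_(w in B n) ((V w + e * `|X w|)%:E + c%:E * (X w)%:E))%E).
  apply: ge0_le_integral => //.
  - by move=> w _; rewrite lee_fin.
  - by apply/measurable_funTS/measurable_EFinP.
  - apply: measurable_funTS; apply: emeasurable_funD; first exact/measurable_EFinP.
    by apply: emeasurable_funM => //; exact/measurable_EFinP.
  - move=> w /cB cw; rewrite -EFinM -EFinD lee_fin (le_trans (UV w))//.
    rewrite -addrA lerD2l -lerBlDr (mulrC c) -mulrBr (le_trans (ler_norm _))//.
    by rewrite normrM mulrC ler_wpM2r.
rewrite integralD//; last exact: integrableZl.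
by rewrite integralZl// X0// mule0 adde0.
Qed.

End v_martingale_step.

Section v_martingale_bound.
Context d (T : measurableType d) {R : realType} (P : probability T R).
Context (f : R -> R) (Ff : F12 f).

Lemma measurable_F12 (X : T -> R) : measurable_fun setT X ->
  measurable_fun setT (f \o X).
Proof.
move=> mX; apply: measurableT_comp mX.
exact: continuous_measurable_fun (F12_continuous Ff).
Qed.

Lemma v_martingale_moment_bound (n : nat) (S : nat -> {RV P >-> R}) :
  f <> cst 0 -> (0 < n)%N -> v_martingale n S ->
  moment_bound P f n (Cf f) (S n) (differences S).
Proof.
move=> fn0; case: n => // n _; elim: n => [|n IH] vS.
  rewrite /moment_bound big_geq// mule0 adde0.
  rewrite (_ : differences S 1 = S 1%N)//.
  by apply/funext => w; rewrite /differences /= subr0.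
have [iX [_ _ X0]] := vS n.+2 (leqnn _).
rewrite /= in X0.
have mX : measurable_fun setT (differences S n.+2).
  exact/measurable_EFinP/(measurable_int _ iX).
have Cge0 : 0 <= fine (Cf f).
  by rewrite -lee_fin -Cf_fin//; apply: le_trans (Cf_ge1 Ff fn0); rewrite lee_fin.
have mfX : measurable_fun setT (f \o differences S n.+2) by exact: measurable_F12.
have mfS k : measurable_fun setT (f \o S k) by exact: measurable_F12.
have step : ('E_P[f \o S n.+2] <=
    'E_P[f \o S n.+1] + Cf f * 'E_P[f \o differences S n.+2])%E.
  rewrite unlock Cf_fin// -ge0_integralZl//; last 2 first.
  - exact/measurable_EFinP.
  - by move=> w _; rewrite lee_fin F12_ge0.
  rewrite -ge0_integralD//; last 4 first.
  - by move=> w _; rewrite lee_fin F12_ge0.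
  - exact/measurable_EFinP.
  - by move=> w _; rewrite -EFinM lee_fin mulr_ge0// F12_ge0.
  - by apply/measurable_EFinP; exact: measurable_funM.
  under [leRHS]eq_integral do rewrite -EFinM -EFinD.
  apply: (@integral_le_cond_mean0 _ _ _ P f^`()%classic _ _
    (differences S n.+2) (S n.+1)) => //.
  - by apply: continuous_measurable_fun; have [[_ ?] _ _ _ _] := Ff.
  - by apply: measurable_funD => //; exact: measurable_funM.
  - by move=> A /X0 ->; rewrite integral0.
  - by move=> w; exact: F12_ge0.
  - by move=> w; rewrite addr_ge0 ?mulr_ge0 ?F12_ge0.
  - move=> w; rewrite addrAC.
    have := F12_upper_tangent Ff fn0 (S n.+1 w) (differences S n.+2 w).
    by rewrite /differences /= subrKC.
apply: (le_trans step); rewrite big_nat_recr//= ge0_muleDr; last 2 first.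
- by apply: sume_ge0 => j _; apply: expectation_ge0 => w; exact: F12_ge0.
- by apply: expectation_ge0 => w; exact: F12_ge0.
rewrite addeA leeD2r// IH// => j /andP[j2 jn]; apply: vS.
by rewrite j2 (leq_trans jn).
Qed.

End v_martingale_bound.

(** * Independent summands *)

Section independence.
Context d (T : measurableType d) {R : realType} (P : probability T R).
Local Open Scope ereal_scope.

Definition indep_events (A E : set T) : Prop := P (A `&` E) = P A * P E.

Lemma dynkin_indep_events (E : set T) : measurable E ->
  dynkin [set A | measurable A /\ indep_events A E].
Proof.
move=> mE; pose r : {nonneg R} := NngNum (fine_ge0 (measure_ge0 P E)).
have r_PE : r%:num%:E = P E by exact: fineK (fin_num_measure _ _ mE).
have rE A : mscale r P A = P A * P E by rewrite /mscale r_PE muleC.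
split.
- by split => //; rewrite /indep_events setTI probability_setT mul1e.
- move=> A [mA iA]; split; first exact: measurableC.
  have e : P (E `\` A) = P E - P A * P E.
    by rewrite -iA setIC; apply: measureD => //; rewrite ltey_eq fin_num_measure.
  rewrite /indep_events setIC -setDE e probability_setC// muleBl ?mul1e//.
  exact: fin_num_measure.
- move=> F tF HF; split; first by apply: bigcup_measurable => k _; case: (HF k).
  have mF k : measurable (F k) by case: (HF k).
  rewrite /indep_events -rE -[LHS]/(mrestr P mE _).
  rewrite (@measure_bigcup _ _ _ (mrestr P mE))// measure_bigcup//.
  by apply: eq_eseriesr => k _; rewrite /= rE; case: (HF k).
Qed.

(** Both sides are integrals of [h] on the line, with respect to the image
    by [X] of [P] restricted to [A], and to [P A] times the law of [X]. *)
Lemma ge0_integral_indep (A : set T) (X : {RV P >-> R}) (h : R -> \bar R) :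
  measurable A ->
  (forall D, measurable D -> indep_events A (X @^-1` D)) ->
  measurable_fun setT h -> (forall y, 0 <= h y) ->
  \int[P]_(w in A) h (X w) = P A * \int[P]_w h (X w).
Proof.
move=> mA iA mh h0.
have mhX : measurable_fun setT (h \o X) by exact: measurableT_comp.
transitivity (\int[mrestr P mA]_w h (X w)).
  rewrite -(setUv A) ge0_integral_setU//=; last 3 first.
  - exact: measurableC.
  - by rewrite setUv.
  - by apply/disj_set2P; rewrite setICr.
  rewrite [X in _ + X]null_set_integral//=; last 3 first.
  - exact: measurableC.
  - exact: measurable_funTS.
  - by rewrite /mrestr setICl measure0.
  rewrite adde0; apply: eq_measure_integral => B mB BA.
  by rewrite -[RHS]/(P (B `&` A)) setIidl.
pose r : {nonneg R} := NngNum (fine_ge0 (measure_ge0 P A)).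
have r_PA : r%:num%:E = P A by exact: fineK (fin_num_measure _ _ mA).
have h0' : {in setT, forall y, 0 <= h y} by [].
have push (m : {measure set T -> \bar R}) :
    \int[m]_w h (X w) = \int[pushforward m X]_y h y.
  by rewrite ge0_integral_pushforward.
rewrite !push -r_PA -ge0_integral_mscale//.
apply: eq_measure_integral => B mB _.
transitivity (P (X @^-1` B `&` A)); first by [].
transitivity (r%:num%:E * P (X @^-1` B)); last by [].
by rewrite r_PA setIC iA.
Qed.

(** Apply [ge0_integral_indep] to the positive and negative parts of [X], whose
    means are finite and equal. *)
Lemma integral_indep_mean0 (A : set T) (X : {RV P >-> R}) :
  measurable A ->
  (forall D, measurable D -> indep_events A (X @^-1` D)) ->
  P.-integrable setT (EFin \o X) -> 'E_P[X] = 0 ->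
  \int[P]_(w in A) (X w)%:E = 0.
Proof.
move=> mA iA iX; rewrite unlock => EX0.
rewrite integralE.
have pE : (fun w => (X w)%:E)^\+ = (fun w => ((@EFin R)^\+ (X w))).
  by apply/funext => w; rewrite !funeposE.
have nE : (fun w => (X w)%:E)^\- = (fun w => ((@EFin R)^\- (X w))).
  by apply/funext => w; rewrite !funenegE.
have mE : measurable_fun setT (@EFin R) by exact/measurable_EFinP.
rewrite pE nE (ge0_integral_indep mA iA (measurable_funepos mE))//.
rewrite (ge0_integral_indep mA iA (measurable_funeneg mE))//.
have ip : P.-integrable setT (fun w => ((@EFin R)^\+ (X w))).
  by rewrite -pE; exact: integrable_funepos.
have fp : \int[P]_w ((@EFin R)^\+ (X w)) \is a fin_num.
  exact: integrable_fin_num.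
rewrite -muleBr ?fin_num_measure//; last by rewrite fin_num_adde_defr.
by rewrite -pE -nE -integralE EX0 mule0.
Qed.

End independence.

Section partial_sums.
Context d (T : measurableType d) {R : realType} (P : probability T R).
Context (X : nat -> {RV P >-> R}).

Definition partial_sum (k : nat) : T -> R := fun w => \sum_(1 <= i < k.+1) X i w.

Lemma partial_sumS k : partial_sum k.+1 = partial_sum k \+ X k.+1.
Proof. by apply/funext => w; rewrite /partial_sum big_nat_recr. Qed.

Lemma measurable_partial_sum k : measurable_fun setT (partial_sum k).
Proof.
elim: k => [|k IH]; last by rewrite partial_sumS; exact: measurable_funD.
rewrite /partial_sum; under eq_fun do rewrite big_nil.
exact: measurable_cst.
Qed.

HB.instance Definition _ k :=
  isMeasurableFun.Build _ _ _ _ (partial_sum k) (measurable_partial_sum k).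

(** A pi-system generating the sigma-algebra of [X 1], ..., [X k]. *)
Definition cylinders (k : nat) : set (set T) :=
  [set A | exists2 B : nat -> set R, (forall i, measurable (B i)) &
    A = [set w | forall i, (1 <= i <= k)%N -> B i (X i w)]].

Lemma setI_closed_cylinders k : setI_closed (cylinders k).
Proof.
move=> _ _ [B mB ->] [B' mB' ->]; exists (fun i => B i `&` B' i).
  by move=> i; exact: measurableI.
apply/seteqP; split=> w /=.
  by move=> [h h'] i ik; split; [exact: h|exact: h'].
by move=> h; split=> i /h[].
Qed.

Lemma preimage_partial_sum_cylinders k (B : set R) : measurable B ->
  <<s cylinders k >> (partial_sum k @^-1` B).
Proof.
move=> mB.
have mX i : (1 <= i <= k)%N ->
    measurable_fun setT (X i : g_sigma_algebraType (cylinders k) -> R).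
  move=> ik _ D mD; rewrite setTI; apply: sub_sigma_algebra.
  exists (fun j => if j == i then D else setT) => [j|].
    by case: ifP.
  apply/seteqP; split=> w /=.
    by move=> Dw j jk; case: ifP => // /eqP ->.
  by move=> /(_ i ik); rewrite eqxx.
suff mS j : (j <= k)%N ->
    measurable_fun setT (partial_sum j : g_sigma_algebraType (cylinders k) -> R).
  by have := mS k (leqnn _) measurableT _ mB; rewrite setTI.
elim: j => [|j IH] jk.
  rewrite /partial_sum; under eq_fun do rewrite big_nil.
  exact: measurable_cst.
rewrite partial_sumS; exact: (measurable_funD (IH (ltnW jk)) (mX j.+1 jk)).
Qed.

(** Independence applied twice: to the first [k] events, and to these together
    with the event on [X k.+1]. *)
Lemma indep_events_cylinder n k (A : set T) (D : set R) :
  independent_RVs [set j | (1 <= j <= n)%N] X -> (k < n)%N ->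
  cylinders k A -> measurable D -> indep_events P A (X k.+1 @^-1` D).
Proof.
move=> iX kn [B mB ->] mD.
pose J := [fset i in iota 1 k]%fset.
have inJ i : (i \in J) = (1 <= i <= k)%N.
  by rewrite !inE mem_iota add1n ltnS.
have kJ : k.+1 \notin J by rewrite inJ /= ltnn.
have AE : [set w | forall i, (1 <= i <= k)%N -> B i (X i w)] =
    \bigcap_(i in [set` J]) (X i @^-1` B i).
  by apply/seteqP; split=> w h i; have := h i; rewrite /= inJ.
pose B' i := if i == k.+1 then D else B i.
have B'J i : i \in J -> B' i = B i.
  by rewrite /B'; case: eqP => // -> kJ'; rewrite kJ' in kJ.
have mB' i : measurable (B' i) by rewrite /B'; case: ifP.
rewrite /indep_events AE iX//; last first.
  by move=> i /=; rewrite inJ => /andP[-> /leq_trans]; apply; exact: ltnW.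
have capE : \bigcap_(i in [set` (k.+1 |` J)%fset]) (X i @^-1` B' i) =
    \bigcap_(i in [set` J]) (X i @^-1` B i) `&` X k.+1 @^-1` D.
  apply/seteqP; split=> w /= h.
    split=> [i /= iJ|]; last first.
      by have := h k.+1; rewrite /= /B' eqxx in_fset1U eqxx; apply.
    by have := h i; rewrite /= B'J// in_fset1U iJ orbT; apply.
  case: h => h1 h2 i; rewrite /= in_fset1U => /orP[/eqP ->|iJ].
    by rewrite /B' eqxx.
  by rewrite B'J//; exact: h1.
have := iX (k.+1 |` J)%fset B'; rewrite big_fsetU1//= capE => ->.
- rewrite {1}/B' eqxx muleC; congr (_ * _)%E.
  by apply: eq_big_seq => i iJ; rewrite B'J.
- move=> i /=; rewrite in_fset1U => /orP[/eqP ->//|]; rewrite inJ.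
  by move=> /andP[-> /leq_trans]; apply; exact: ltnW.
- by move=> i _.
Qed.

Lemma differences_partial_sum k :
  differences (fun k => partial_sum k : {RV P >-> R}) k.+1 = X k.+1.
Proof.
apply/funext => w; rewrite /differences; case: k => [|k] /=.
  by rewrite subr0 /partial_sum big_nat1.
by rewrite partial_sumS /= addrAC subrr add0r.
Qed.

(** By Dynkin's theorem, the independence of [X j.+2] from the cylinders on the
    previous variables extends to the sigma-algebra that they generate, which
    contains the events on the partial sum. *)
Lemma independent_v_martingale n :
  independent_zero_mean n X ->
  v_martingale n (fun k => partial_sum k : {RV P >-> R}).
Proof.
move=> [iX X0] [|[|j]] // /andP[_ jn].
have [intX EX0] := X0 j.+2 jn.
rewrite differences_partial_sum; split=> //; split.
- by apply/integrable0.
- move=> B mB; exists (if 0 \in B then setT else set0); first by case: ifP.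
  rewrite setTI; apply/seteqP; split=> w /=.
    by case: ifP => // /set_mem.
  by move=> B0; rewrite ifT//; exact/mem_set.
- move=> _ [B mB <-]; rewrite setTI integral0.
  apply: integral_indep_mean0 => //.
    by rewrite -[X in measurable X]setTI; exact: measurable_partial_sum.
  move=> D mD.
  have mE : measurable (X j.+2 @^-1` D).
    by rewrite -[X in measurable X]setTI; exact: measurable_funP.
  have := smallest_sub (dynkin_indep_events P mE).
  move=> /(_ (cylinders j.+1)) H.
  suff /H : cylinders j.+1 `<=`
      [set A | measurable A /\ indep_events P A (X j.+2 @^-1` D)].
    move=> /(_ (partial_sum j.+1 @^-1` B)); case => //.
    rewrite -/(<<d cylinders j.+1 >> _) setI_closed_g_dynkin_g_sigma_algebra.
      exact: preimage_partial_sum_cylinders.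
    exact: setI_closed_cylinders.
  move=> A cA; split; last exact: (indep_events_cylinder iX jn cA mD).
  case: cA => C mC ->.
  rewrite (_ : [set w | _] =
    \bigcap_(i in [set i | (1 <= i <= j.+1)%N]) (X i @^-1` C i))//.
  apply: bigcap_measurable => [|i _]; first by exists 1%N.
  by rewrite -[X in measurable X]setTI; exact: measurable_funP.
Qed.

End partial_sums.

(** * Two independent two-point variables *)

Section two_coins.
Context {R : realType} (p q : R) (p01 : 0 <= p <= 1) (q01 : 0 <= q <= 1).
Local Open Scope ereal_scope.

Definition two_coins : probability (bool * bool)%type R :=
  (bernoulli_prob p \x bernoulli_prob q)%E.

Lemma measurable_fun_bool2 (F : bool * bool -> R) : measurable_fun setT F.
Proof.
move=> _ B mB; apply: countable_measurable; last exact: countableP.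
move=> [a b]; rewrite (_ : [set (a, b)] = [set a] `*` [set b]).
  exact: measurableX.
by apply/seteqP; split; case=> x y /= [-> ->].
Qed.

Definition coins_mean (F : bool * bool -> R) : R :=
  (p * (q * F (true, true) + (1 - q) * F (true, false)) +
   (1 - p) * (q * F (false, true) + (1 - q) * F (false, false)))%R.

Lemma ge0_integral_two_coins (F : bool * bool -> R) :
  (forall w, (0 <= F w)%R) -> \int[two_coins]_w (F w)%:E = (coins_mean F)%:E.
Proof.
move=> F0; rewrite fubini_tonelli1//; last first.
  by apply/measurable_EFinP; exact: measurable_fun_bool2.
rewrite integral_bernoulli_prob//; last first.
  by move=> a; apply: integral_ge0 => b _; rewrite lee_fin.
rewrite /fubini_F !integral_bernoulli_prob//.
all: by move=> b; rewrite lee_fin.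
Qed.

Lemma integrable_two_coins (F : bool * bool -> R) :
  two_coins.-integrable setT (EFin \o F).
Proof.
apply: measurable_bounded_integrable => //.
- by apply: (@le_lt_trans _ _ 1); [exact: probability_le1|exact: ltry].
- exact: measurable_fun_bool2.
- exists (\sum_w `|F w|)%R; split; first by rewrite num_real.
  move=> M ltM w _ /=; apply: le_trans (ltW ltM).
  by rewrite (bigD1 w)//= lerDl sumr_ge0.
Qed.

(** Signed integrands are shifted by a constant to become nonnegative. *)
Lemma integral_two_coins (F : bool * bool -> R) :
  \int[two_coins]_w (F w)%:E = (coins_mean F)%:E.
Proof.
pose K : R := (\sum_w `|F w|)%R.
have FK0 w : (0 <= F w + K)%R.
  have : (`|F w| <= K)%R by rewrite /K (bigD1 w)//= lerDl sumr_ge0.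
  by move=> /ler_normlP[]; lra.
have := ge0_integral_two_coins FK0.
under eq_integral do rewrite EFinD.
rewrite (integralD _ (integrable_two_coins F) (integrable_two_coins (fun=> K)))//.
have := @ge0_integral_two_coins (fun=> K) (fun=> sumr_ge0 _ (fun w _ => normr_ge0 (F w))).
move=> ->; rewrite -(@fineK _ (\int[two_coins]_w (F w)%:E)); last first.
  exact: integrable_fin_num (integrable_two_coins F).
rewrite -EFinD => -[] H; congr EFin; move: H; rewrite /coins_mean; lra.
Qed.

End two_coins.

(** Sure and impossible events are independent of everything, so one other event
    is harmless. *)
Lemma independent_trivial_but_one d (T : measurableType d) (R : realType)
    (P : probability T R) (i : nat) (A : nat -> set T) (J : {fset nat}) :
  measurable (A i) ->
  (forall j, j != i -> A j = setT \/ A j = set0) ->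
  P (\bigcap_(j in [set` J]) A j) = (\prod_(j <- J) P (A j))%E.
Proof.
move=> mAi Ai.
have capU (a : nat) (K : {fset nat}) : \bigcap_(j in [set` (a |` K)%fset]) A j =
    A a `&` \bigcap_(j in [set` K]) A j.
  apply/seteqP; split=> w.
    move=> h; split=> [|j jK]; apply: h; rewrite /= in_fset1U ?eqxx//.
    by rewrite jK orbT.
  by move=> [h1 h2] j /=; rewrite in_fset1U => /orP[/eqP ->//|]; exact: h2.
have trivial (K : {fset nat}) : i \notin K ->
    \bigcap_(j in [set` K]) A j = setT \/ \bigcap_(j in [set` K]) A j = set0.
  elim/fset1U_rect: K => [_|a K aK IH iaK].
    by left; apply/seteqP; split=> // w _ j /=; rewrite inE.
  move: iaK; rewrite in_fset1U negb_or capU => /andP[ia /IH].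
  have := Ai a; rewrite eq_sym => /(_ ia)[|] ->; rewrite ?setTI ?set0I; last by right.
  by [].
have PI0 (B C : set T) : (B = setT \/ B = set0) -> P (B `&` C) = (P B * P C)%E.
  by move=> [] ->; rewrite ?setTI ?set0I ?measure0 ?mul0e ?probability_setT ?mul1e.
elim/fset1U_rect: J => [|a K aK IH].
  rewrite big_seq_fset0 (_ : \bigcap_(_ in _) _ = setT) ?probability_setT//.
  by apply/seteqP; split=> // w _ j /=; rewrite inE.
rewrite capU big_fsetU1//= -IH.
have [ai|ai] := eqVneq a i; last by rewrite PI0//; exact: Ai.
rewrite setIC PI0 1?muleC//; apply: trivial; by rewrite -ai.
Qed.

Section two_point_sequence.
Context {R : realType} (p q : R) (p01 : 0 <= p <= 1) (q01 : 0 <= q <= 1).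
Context (u v : bool -> R).
Local Notation P := (two_coins p q).

(** The first two terms are driven by one coin each; the others vanish, so that
    two variables suffice for any number of summands. *)
Definition coin_fun (j : nat) (w : bool * bool) : R :=
  if j == 1%N then u w.1 else if j == 2%N then v w.2 else 0.

HB.instance Definition _ j :=
  isMeasurableFun.Build _ _ _ _ (coin_fun j) (measurable_fun_bool2 (coin_fun j)).

Definition coin_seq (j : nat) : {RV P >-> R} := coin_fun j.

(** The event on the [j]-th term is a rectangle [A1 j `*` A2 j]; only [A1 1] and
    [A2 2] can be nontrivial, and both coordinates are independent. *)
Lemma independent_coin_seq (I : set nat) : independent_RVs I coin_seq.
Proof.
move=> J B _ _.
pose A1 j := if j == 1%N then u @^-1` B j else
  if j == 2%N then setT else (fun=> 0 : R) @^-1` B j.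
pose A2 j := if j == 2%N then v @^-1` B j else [set: bool].
have coinE j : coin_fun j @^-1` B j = A1 j `*` A2 j.
  rewrite /A1 /A2 /coin_fun; case: (j =P 1%N) => [->|j1].
    by apply/seteqP; split=> w //= [].
  case: (j =P 2%N) => [->|j2].
    by apply/seteqP; split=> w //= [].
  by apply/seteqP; split=> w //= [].
have AE j : coin_seq j @^-1` B j = A1 j `*` A2 j by exact: coinE.
have PE (C1 C2 : set bool) : P (C1 `*` C2) =
    (bernoulli_prob p C1 * bernoulli_prob q C2)%E.
  by apply: product_measure1E.
have capE : \bigcap_(j in [set` J]) (coin_seq j @^-1` B j) =
    \bigcap_(j in [set` J]) A1 j `*` \bigcap_(j in [set` J]) A2 j.
  under eq_bigcapr do rewrite AE.
  apply/seteqP; split=> w.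
    by move=> h; split=> j /h[].
  by move=> [h1 h2] j jJ; split; [exact: h1|exact: h2].
under eq_bigr do rewrite AE PE.
rewrite capE PE big_split /=; congr (_ * _)%E.
- apply: (@independent_trivial_but_one _ _ _ _ 1) => // j j1.
  rewrite /A1 (negbTE j1); case: ifP => _; first by left.
  by have [B0|B0] := pselect (B j 0); [left|right];
    apply/seteqP; split=> b //=.
- apply: (@independent_trivial_but_one _ _ _ _ 2) => // j j2.
  by left; rewrite /A2 (negbTE j2).
Qed.

Lemma expectation_coin_seq (h : R -> R) (n : nat) : (2 <= n)%N ->
  let m := coins_mean p q in
  [/\ ('E_P[h \o coin_seq 1] = (m (fun w => h (u w.1)))%:E)%E,
      ('E_P[h \o coin_seq 2] = (m (fun w => h (v w.2)))%:E)%E,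
      (\sum_(2 <= j < n.+1) 'E_P[h \o coin_seq j] =
        (m (fun w => h (v w.2)) + h 0 *+ (n - 2))%:E)%E &
      ('E_P[h \o (fun w => \sum_(1 <= j < n.+1) coin_seq j w)%R] =
        (m (fun w => h (u w.1 + v w.2)%R))%:E)%E].
Proof.
move=> n2 m; have EE (F : bool * bool -> R) : ('E_P[F] = (m F)%:E)%E.
  by rewrite unlock integral_two_coins.
split; rewrite ?EE//.
- under eq_bigr do rewrite EE.
  rewrite sumEFin; congr EFin; rewrite big_ltn//; congr (_ + _).
  rewrite big_nat (eq_bigr (fun=> h 0)).
    by rewrite -big_nat sumr_const_nat subSS.
  move=> j /andP[j2 _]; rewrite /m /coins_mean /= /coin_fun.
  rewrite !gtn_eqF//; last exact: ltn_trans j2.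
  by ring.
- congr (m _)%:E; apply/funext => w /=; congr h.
  rewrite big_ltn; last by rewrite ltnS ltnW.
  rewrite big_ltn// big_nat big1 ?addr0//.
  move=> j /andP[j2 _]; rewrite /coin_fun !gtn_eqF//.
  exact: ltn_trans j2.
Qed.

Lemma coin_seq_zero_mean n :
  p * u true + (1 - p) * u false = 0 -> q * v true + (1 - q) * v false = 0 ->
  independent_zero_mean n coin_seq.
Proof.
move=> u0 v0; split; first exact: independent_coin_seq.
move=> j _; split; first exact: integrable_two_coins.
rewrite unlock integral_two_coins//; congr EFin.
rewrite /coins_mean /= /coin_fun.
case: eqP => _; first by rewrite -[RHS]u0; ring.
case: eqP => _; last by ring.
by rewrite v0; ring.
Qed.

End two_point_sequence.

(** * Optimality of the constant *)

Lemma ratio_itv01 {R : realFieldType} (a b : R) : 0 < a -> 0 < b ->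
  0 <= b / (a + b) <= 1.
Proof.
move=> a0 b0; have ab := addr_gt0 a0 b0.
rewrite divr_ge0 ?(ltW b0) ?(ltW ab)//=.
by rewrite ler_pdivrMr// mul1r lerDr ltW.
Qed.

Section sharpness.
Context {R : realType} (f : R -> R) (Ff : F12 f) (fn0 : f <> cst 0).
Local Notation g := (f^`()%classic).
Context (n : nat) (n2 : (2 <= n)%N).

Lemma independent_constants_two_points (C : \bar R) (p q : R) (u v : bool -> R) :
  0 <= p <= 1 -> 0 <= q <= 1 ->
  p * u true + (1 - p) * u false = 0 -> q * v true + (1 - q) * v false = 0 ->
  independent_constants f n C ->
  ((coins_mean p q (fun w => f (u w.1 + v w.2)))%:E <=
   (coins_mean p q (fun w => f (u w.1)))%:E +
   C * (coins_mean p q (fun w => f (v w.2)))%:E)%E.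
Proof.
move=> p01 q01 u0 v0 CC; have [_ f0 _ _ _] := Ff.
have := CC _ _ _ _ (coin_seq_zero_mean p01 q01 n u0 v0).
have [e1 e2 e3 e4] := expectation_coin_seq p01 q01 u v f n2.
by rewrite /moment_bound e4 e1 e3 f0 mul0rn addr0.
Qed.

(** The two probabilities are those for which a variable with values [x], [- y] and
    one with values [- s], [dl] have mean zero. *)
Lemma independent_constants_four_params (C : \bar R) (x s y dl p q : R) :
  0 < x -> 0 < s -> 0 < y -> 0 < dl ->
  p = y / (x + y) -> q = dl / (s + dl) ->
  independent_constants f n C ->
  ((p * (q * f (x - s) + (1 - q) * f (x + dl)) +
    (1 - p) * (q * f (- y - s) + (1 - q) * f (- y + dl)))%:E <=
   (p * f x + (1 - p) * f (- y))%:E + C * (q * f s + (1 - q) * f dl)%:E)%E.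
Proof.
move=> x0 s0 y0 d0 pE qE CC; have [_ _ fe _ _] := Ff.
have xy : x + y != 0 by rewrite gt_eqF// addr_gt0.
have sd : s + dl != 0 by rewrite gt_eqF// addr_gt0.
have p01 : 0 <= p <= 1.
  by rewrite pE; exact: ratio_itv01.
have q01 : 0 <= q <= 1.
  by rewrite qE; exact: ratio_itv01.
have := @independent_constants_two_points C p q (fun b => if b then x else - y)
  (fun b => if b then - s else dl) p01 q01.
rewrite /= /coins_mean /= (fe s) => H.
rewrite (_ : p * f x + (1 - p) * f (- y) = p * (q * f x + (1 - q) * f x) +
    (1 - p) * (q * f (- y) + (1 - q) * f (- y))); last by ring.
rewrite (_ : q * f s + (1 - q) * f dl = p * (q * f s + (1 - q) * f dl) +
    (1 - p) * (q * f s + (1 - q) * f dl)); last by ring.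
by apply: H CC; rewrite ?pE ?qE; field.
Qed.

(** The atom [- y] only helps, by convexity, and its mass tends to [0] as [y]
    grows, which leaves the contribution of [x]. *)
Lemma independent_constants_increment (c x s dl : R) :
  0 < x -> 0 < s -> 0 < dl -> independent_constants f n c%:E ->
  dl * (f (x - s) - f x) + s * (f (x + dl) - f x) <= c * (dl * f s + s * f dl).
Proof.
move=> x0 s0 d0 CC; rewrite leNgt; apply/negP.
set A := (X in _ < X); set E := (X in X < _) => EA.
have AE0 : 0 < A - E by rewrite subr_gt0.
(* Chosen so that [y * (A - E)] exceeds [x * E], which bounds it when [CC] is
   applied with this [y]. *)
pose y := (x * `|E| + 1) / (A - E).
have y0 : 0 < y.
  by rewrite divr_gt0// ltr_wpDl// mulr_ge0// ltW.
have xy : 0 < x + y by rewrite addr_gt0.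
have sd : 0 < s + dl by rewrite addr_gt0.
have := independent_constants_four_params x0 s0 y0 d0 erefl erefl CC.
rewrite -EFinM -EFinD lee_fin => H.
have {}H : y * (dl * f (x - s) + s * f (x + dl)) +
    x * (dl * f (- y - s) + s * f (- y + dl)) <=
    (s + dl) * (y * f x + x * f (- y)) + (x + y) * E.
  have := ler_wpM2l (ltW (mulr_gt0 xy sd)) H.
  rewrite /E; congr (_ <= _); field; by rewrite ?gt_eqF.
have t1 := F12_tangent Ff (- y) (- s); have t2 := F12_tangent Ff (- y) dl.
have t3 : (s + dl) * f (- y) <= dl * f (- y - s) + s * f (- y + dl).
  have := ler_wpM2l (ltW d0) t1; have := ler_wpM2l (ltW s0) t2; lra.
have t4 := ler_wpM2l (ltW x0) t3.
have yAE : y * (A - E) = x * `|E| + 1 by rewrite /y mulfVK// gt_eqF.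
have := ler_wpM2l (ltW x0) (ler_norm E).
by move: yAE; rewrite /A; lra.
Qed.

(** Take [x = s = dl = 1]: by convexity the left-hand side of
    [independent_constants_increment] is nonnegative. *)
Lemma independent_constants_ge0 (c : R) :
  independent_constants f n c%:E -> 0 <= c.
Proof.
move=> CC; have := independent_constants_increment ltr01 ltr01 ltr01 CC.
have t1 := F12_tangent Ff 1 (- 1); have t2 := F12_tangent Ff 1 1.
have f1 := F12_gt0 Ff fn0 ltr01.
rewrite !mul1r => H; have {}H : 0 <= c * (f 1 + f 1) by lra.
by move: H; rewrite pmulr_lge0// addr_gt0.
Qed.

(** Let [dl] tend to [0] in [independent_constants_increment], after division by
    [dl]: the tangent at [x] bounds [f (x + dl) - f x] from below, and
    [f dl <= dl * g dl] with [g dl] tending to [0]. *)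
Lemma Lfs_le_independent_constants (c x s : R) : 0 < x -> 0 < s ->
  independent_constants f n c%:E -> Lfs f s x <= c * f s.
Proof.
move=> x0 s0 CC; have c0 := independent_constants_ge0 CC.
have le_dl dl : 0 < dl -> Lfs f s x <= c * (f s + s * g dl).
  move=> d0; rewrite -(ler_pM2l d0).
  have H := independent_constants_increment x0 s0 d0 CC.
  have t1 := ler_wpM2l (ltW s0) (F12_tangent Ff x dl).
  have t2 : f dl <= dl * g dl.
    have [_ f0 _ _ _] := Ff.
    by have := F12_tangent Ff dl (- dl); rewrite subrr f0; lra.
  have t3 := ler_wpM2l c0 (ler_wpM2l (ltW s0) t2).
  rewrite /Lfs; lra.
have [[_ cg] _ _ _ _] := Ff.
have cv : (fun dl => c * (f s + s * g dl)) dl @[dl --> 0^'+] -->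
    c * (f s + s * g 0).
  apply: cvgM; first exact: cvg_cst.
  apply: cvgD; first exact: cvg_cst.
  by apply: cvgM; [exact: cvg_cst|apply: cvg_at_right_filter; exact: cg].
move: cv; rewrite F12_derive0// mulr0 addr0 => /cvgr_to_ge; apply.
by near=> dl; apply: le_dl; near: dl; exact: nbhs_right_gt.
Unshelve. all: by end_near. Qed.

(** The constants range over the extended reals; [-oo] is excluded by any
    nondegenerate instance of the bound. *)
Lemma Cf_le_independent_constants (C : \bar R) :
  independent_constants f n C -> (Cf f <= C)%E.
Proof.
case: C => [c| |] CC; last first.
- exfalso.
  have := independent_constants_four_params ltr01 ltr01 ltr01 ltr01 erefl erefl CC.
  have f1 := F12_gt0 Ff fn0 ltr01.
  set e := (X in (-oo * X%:E)%E).
  have e0 : 0 < e by rewrite /e -mulrDl addrC subrK mul1r.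
  by rewrite gt0_mulNye ?lte_fin.
- exact: leey.
apply: ge_ereal_sup => _ [x [s [/andP[x0 xs] ->]]].
have s0 := lt_trans x0 xs.
rewrite lee_fin ler_pdivrMr; last exact: F12_gt0.
exact: Lfs_le_independent_constants.
Qed.

End sharpness.

Lemma v_martingale_constants_sub {R : realType} (f : R -> R) (n : nat) :
  v_martingale_constants f n `<=` independent_constants f n.
Proof.
move=> C CC d T P X iX; have := CC _ _ _ _ (independent_v_martingale iX).
have dE j : (1 <= j)%N ->
    differences (fun k => partial_sum X k : {RV P >-> R}) j = X j.
  by case: j => // j _; exact: differences_partial_sum.
rewrite /moment_bound dE//.
rewrite [X in (_ * X)%E](_ : _ = (\sum_(2 <= j < n.+1) 'E_P[f \o X j])%E)//.
by apply: eq_big_nat => j /andP[j2 _]; rewrite dE// ltnW.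
Qed.

(** * Functions realizing every constant *)

Section example_family.
Context {R : realType}.
Implicit Types (k t s x y z : R).

(** Differentiates functions such as [pos_part z ^+ 2], whose derivative has a kink,
    without a discussion of one-sided limits at the kink. *)
Lemma is_derive_quadratic_error (F : R -> R) x (l : R) :
  (forall h, `|F (x + h) - F x - h * l| <= h ^+ 2) -> is_derive x 1 F l.
Proof.
move=> FE.
have cv : h^-1 *: ((F \o shift x) (h *: 1) - F x) @[h --> 0^'] --> l.
  apply/cvgrPdist_le => e e0; near=> h.
  have h0 : h != 0 by near: h; exact: nbhs_dnbhs_neq.
  have he : `|h| <= e by near: h; exact: dnbhs0_le.
  apply: le_trans he.
  rewrite /= scaler1 /shift /= -(@ler_pM2l _ `|h|) ?normr_gt0//.
  rewrite -normrM mulrBr [h * (_ *: _)]mulVKf// -expr2 real_normK ?num_real//.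
  by rewrite -normrN opprB (addrC h).
apply: DeriveDef; first by apply/cvg_ex; exists l.
exact: cvg_lim cv.
Unshelve. all: by end_near. Qed.

Definition pos_part z : R := Num.max z 0.

Lemma pos_partP z : pos_part z = if 0 <= z then z else 0.
Proof. by rewrite /pos_part; case: leP. Qed.

Lemma pos_part_convex t x y : 0 <= t <= 1 ->
  pos_part (t * x + (1 - t) * y) <= t * pos_part x + (1 - t) * pos_part y.
Proof.
move=> /andP[t0 t1]; have u0 : 0 <= 1 - t by rewrite subr_ge0.
have lep z : z <= pos_part z by rewrite /pos_part le_max lexx.
have ge0 z : 0 <= pos_part z by rewrite /pos_part le_max lexx orbT.
rewrite [leLHS]/pos_part ge_max addr_ge0 ?mulr_ge0// andbT.
by rewrite lerD// ler_wpM2l.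
Qed.

Lemma pos_part0 z : z <= 0 -> pos_part z = 0.
Proof. by move=> z0; rewrite /pos_part max_r. Qed.

Lemma continuous_pos_part : continuous pos_part.
Proof.
move=> z; rewrite (_ : pos_part = fun z => (z + `|z|) / 2); last first.
  by apply/funext => y; rewrite /pos_part maxr_absE addr0 subr0.
apply: cvgM; last exact: cvg_cst.
by apply: cvgD; [exact: cvg_id|exact: norm_continuous].
Qed.

Lemma is_derive_pos_part_sq z :
  is_derive z 1 (fun z => pos_part z ^+ 2) (2 * pos_part z).
Proof.
apply: is_derive_quadratic_error => h; rewrite !pos_partP ler_norml.
by case: ifPn; case: ifPn; rewrite -?ltNge => *; apply/andP; split; nra.
Qed.

(** The even function whose derivative [bent' k] has slope [1] up to [1]
    and slope [1 - k] beyond: half a square for [k = 0], a Huber function for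
    [k = 1]. *)
Definition bent k x : R :=
  (x ^+ 2 - k * (pos_part (x - 1) ^+ 2 + pos_part (- x - 1) ^+ 2)) / 2.

Definition bent' k x : R :=
  x - k * (pos_part (x - 1) - pos_part (- x - 1)).

Lemma is_derive_bent k x : is_derive x 1 (bent k) (bent' k x).
Proof.
have d1 := is_derive_affine (-1) 1 x is_derive_pos_part_sq.
have d2 := is_derive_affine (-1) (-1) x is_derive_pos_part_sq.
rewrite (_ : bent k = fun x => 2^-1 * (x * x - k *
    (pos_part (- 1 + 1 * x) ^+ 2 + pos_part (- 1 + (- 1) * x) ^+ 2))); last first.
  apply/funext => y; rewrite /bent mul1r mulN1r (addrC (- 1) y) (addrC (- 1) (- y)).
  by rewrite mulrC expr2.
apply: is_derive_eq; rewrite /bent' !mul1r !mulN1r (addrC (- 1) x) (addrC (- 1) (- x)).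
rewrite /GRing.scale /=.
by field.
Qed.

Lemma derive_bent k : (bent k)^`()%classic = bent' k.
Proof.
by apply/funext => x; rewrite derive1E; have [_ ->] := is_derive_bent k x.
Qed.

Lemma F12_bent k : 0 <= k <= 1 -> F12_nonzero (bent k).
Proof.
move=> /andP[k0 k1]; split; last first.
  move=> /(congr1 (fun h : R -> R => h 1)); rewrite /bent /= !pos_partP.
  rewrite subrr lexx ifF; last by apply/negbTE; rewrite -ltNge; lra.
  by move=> /eqP; rewrite !expr0n /= addr0 mulr0 subr0 expr1n; lra.
split; rewrite ?derive_bent.
- split; first by move=> x; have [] := is_derive_bent k x.
  move=> x; apply: cvgB; first exact: cvg_id.
  apply: cvgM; first exact: cvg_cst.
  apply: cvgB.
    apply: (@continuous_comp _ _ _ (fun x => x - 1) pos_part).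
      by apply: cvgB; [exact: cvg_id|exact: cvg_cst].
    exact: continuous_pos_part.
  apply: (@continuous_comp _ _ _ (fun x => - x - 1) pos_part).
    by apply: cvgB; [apply: cvgN; exact: cvg_id|exact: cvg_cst].
  exact: continuous_pos_part.
- rewrite /bent !pos_partP ifF; last by apply/negbTE; rewrite -ltNge; lra.
  rewrite ifF; last by apply/negbTE; rewrite -ltNge; lra.
  by rewrite !expr0n /= addr0 mulr0 subr0 mul0r.
- by move=> x; rewrite /bent opprK sqrrN (addrC (pos_part (- x - 1) ^+ 2)).
- move=> x y; rewrite !inE /= !in_itv /= !andbT => x0 y0 xy.
  rewrite /bent' !pos_partP.
  by do 4 (case: ifPn; rewrite -?ltNge => ?); nra.
- have main t x y : 0 <= t <= 1 -> 0 <= x -> 0 <= y ->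
    - bent' k (t * x + (1 - t) * y) <= t * - bent' k x + (1 - t) * - bent' k y.
    move=> t01 x0 y0; have /andP[t0 t1] := t01.
    have xy : 0 <= t * x + (1 - t) * y by rewrite addr_ge0 ?mulr_ge0// subr_ge0.
    rewrite /bent' !(@pos_part0 (- _ - 1)); [|lra..].
    have := ler_wpM2l k0 (pos_part_convex (x - 1) (y - 1) t01).
    rewrite (_ : t * (x - 1) + _ = t * x + (1 - t) * y - 1); last by ring.
    by rewrite !subr0; lra.
  move=> t x y; rewrite !inE /= !in_itv /= !andbT => x0 y0.
  by apply: main => //; apply/andP; split; [exact: ge0|exact: le1].
Qed.

End example_family.

Section bent_constant.
Context {R : realType}.
Implicit Types (k t s x : R).

Lemma Lfs_bent k s x : 0 < x < s -> Lfs (bent k) s x =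
  (s ^+ 2 - k * (pos_part (s - x - 1) ^+ 2 - pos_part (x - 1) ^+ 2 +
                 2 * s * pos_part (x - 1))) / 2.
Proof.
move=> /andP[x0 xs]; rewrite /Lfs derive_bent /bent /bent' opprB.
by rewrite !(@pos_part0 _ (- x - 1)) ?(@pos_part0 _ (x - s - 1)); [field|lra..].
Qed.

Lemma bentE k s : 0 < s -> bent k s = (s ^+ 2 - k * pos_part (s - 1) ^+ 2) / 2.
Proof.
by move=> s0; rewrite /bent (@pos_part0 _ (- s - 1)); [rewrite expr0n addr0|lra].
Qed.

(** Up to a factor [- k / 2], the right-hand side is the part of [Lfs (bent k) s x]
    that depends on [x], and the left-hand side is its value at [x = 1]. *)
Lemma Lfs_bent_worst s x : 0 < x < s ->
  pos_part (s - 2) ^+ 2 <=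
  pos_part (s - x - 1) ^+ 2 - pos_part (x - 1) ^+ 2 + 2 * s * pos_part (x - 1).
Proof.
move=> /andP[x0 xs]; rewrite !pos_partP.
by do 3 (case: ifPn; rewrite -?ltNge => ?); nra.
Qed.

(** For [s >= 2] the difference of the two sides is the square of
    [(1 - t) * s - (3 - t)], whose root is the extremal [s]. *)
Lemma bent_quadratic t s : 0 <= t <= 1 -> 0 < s ->
  (3 - t) * ((1 + t) * pos_part (s - 1) ^+ 2 - pos_part (s - 2) ^+ 2) <=
  (1 + t) * s ^+ 2.
Proof.
move=> /andP[t0 t1] s0; rewrite !pos_partP.
case: ifPn; rewrite -?ltNge => h1; case: ifPn; rewrite -?ltNge => h2.
- rewrite -subr_ge0 (_ : _ - _ = ((1 - t) * s - (3 - t)) ^+ 2) ?sqr_ge0//.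
  by ring.
- rewrite expr0n subr0 mulrCA ler_pM2l; last by lra.
  by nra.
- lra.
- by rewrite !expr0n subr0 !mulr0 mulr_ge0 ?sqr_ge0//; lra.
Qed.

(** [Lfs_bent_worst] and [bent_quadratic] give the upper bound. At [x = 1] it is attained for
    [s = (3 - t) / (1 - t)], or in the limit of large [s] if [t = 1]. *)
Lemma Cf_bent t : 0 <= t <= 1 ->
  Cf (bent (t * (3 - t) / (1 + t))) = (1 + t)%:E.
Proof.
move=> t01; have /andP[t0 t1] := t01.
set k := _ / _; have t1p : 0 < 1 + t by lra.
have kE : (1 + t) * k = t * (3 - t) by rewrite /k mulrC mulfVK// gt_eqF.
have k01 : 0 <= k <= 1.
  rewrite /k divr_ge0 ?(ltW t1p)//=; last by apply: mulr_ge0; lra.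
  by rewrite ler_pdivrMr// mul1r -subr_ge0
    (_ : _ - _ = (1 - t) ^+ 2) ?sqr_ge0//; ring.
have k0 : 0 <= k by case/andP: k01.
have [Fk nk] := F12_bent k01.
apply/eqP; rewrite eq_le; apply/andP; split.
  apply: ge_ereal_sup => _ [x [s [xs ->]]].
  have s0 : 0 < s by case/andP: xs; exact: lt_trans.
  rewrite lee_fin ler_pdivrMr; last exact: F12_gt0.
  rewrite Lfs_bent// bentE//.
  have h1 := ler_wpM2l k0 (Lfs_bent_worst xs).
  have h2 := ler_wpM2l t0 (bent_quadratic t01 s0).
  suff : k * ((1 + t) * pos_part (s - 1) ^+ 2 - pos_part (s - 2) ^+ 2) <=
      t * s ^+ 2 by lra.
  rewrite -(ler_pM2l t1p) mulrA kE; lra.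
have [t1'|t1'] := ltP t 1; last first.
  have {}t1 : t = 1 by apply/eqP; rewrite eq_le t1.
  have k1 : k = 1 by rewrite /k t1; field.
  rewrite Cf_fin// lee_fin leNgt; apply/negP.
  set c := fine _ => c2.
  have c2' : 0 < 2 - c by rewrite t1 in c2; lra.
  (* At [x = 1], [k = 1] the quotient is [(2 * s - 2) / (s - 1 / 2)], and being at
     most [c] forces [(s - 2) * (2 - c) <= 3 / 2 * c - 2 < 1]. *)
  pose s := 2 + 3 / (2 - c).
  have sE : (s - 2) * (2 - c) = 3 by rewrite /s addrAC subrr add0r mulfVK// gt_eqF.
  have s2 : 2 < s by rewrite /s ltrDl divr_gt0.
  have := @Cf_ge _ (bent k) s 1; rewrite Cf_fin// -/c lee_fin ltr01.
  have s1 : 1 < s by lra.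
  rewrite s1 => /(_ isT); rewrite ler_pdivrMr; last by apply: F12_gt0 => //; lra.
  rewrite Lfs_bent ?ltr01// bentE; last by lra.
  rewrite k1 !pos_partP subrr lexx.
  do 2 (rewrite ifT; last by lra).
  by rewrite expr0n /=; nra.
pose s := (3 - t) / (1 - t).
have sE : s * (1 - t) = 3 - t by rewrite /s mulfVK// gt_eqF// subr_gt0.
have s2 : 2 < s by rewrite /s ltr_pdivlMr ?subr_gt0//; lra.
have s1 : 1 < s by lra.
have -> : 1 + t = Lfs (bent k) s 1 / bent k s.
  apply/(canRL (mulfK _)); first by rewrite gt_eqF// F12_gt0//; lra.
  rewrite Lfs_bent ?ltr01// bentE; last by lra.
  rewrite !pos_partP subrr lexx.
  do 2 (rewrite ifT; last by lra).
  rewrite expr0n /=.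
  suff : t * s ^+ 2 = k * ((1 + t) * (s - 1) ^+ 2 - (s - 2) ^+ 2) by move=> e; lra.
  apply: (mulfI (lt0r_neq0 t1p)); rewrite [RHS]mulrA kE.
  apply/eqP; rewrite -subr_eq0.
  rewrite (_ : _ - _ = t * (s * (1 - t) - (3 - t)) ^+ 2); last by ring.
  by rewrite sE subrr expr0n mulr0.
by apply: Cf_ge; rewrite ltr01.
Qed.

End bent_constant.

Theorem theorem1p1 (R : realType) :
  [/\ (* (I) *)
      forall (f : R -> R) (n : nat), F12_nonzero f -> (2 <= n)%N ->
        forall (d : measure_display) (T : measurableType d)
               (P : probability T R) (S : nat -> {RV P >-> R}),
          v_martingale n S ->
          moment_bound P f n (Cf f) (S n) (differences S),
      (* (II) *)
      forall (f : R -> R) (n : nat), F12_nonzero f -> (2 <= n)%N ->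
        is_smallest (v_martingale_constants f n) (Cf f) /\
        is_smallest (independent_constants f n) (Cf f),
      (* (III) *)
      forall f : R -> R, F12_nonzero f -> (1%:E <= Cf f <= 2%:E)%E &
      (* (IV) *)
      [/\ forall C : R, 1 <= C <= 2 ->
            exists f : R -> R, F12_nonzero f /\ Cf f = C%:E,
          forall a : \bar R,
            (forall f : R -> R, F12_nonzero f -> (a <= Cf f)%E) ->
            (a <= 1%:E)%E &
          forall b : \bar R,
            (forall f : R -> R, F12_nonzero f -> (Cf f <= b)%E) ->
            (2%:E <= b)%E]].
Proof.
have bound (f : R -> R) (n : nat) : F12_nonzero f -> (2 <= n)%N ->
    v_martingale_constants f n (Cf f).
  move=> [Ff fn0] n2 d T P S.
  by apply: v_martingale_moment_bound => //; exact: ltnW.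
have attained (C : R) : 1 <= C <= 2 ->
    exists f : R -> R, F12_nonzero f /\ Cf f = C%:E.
  move=> /andP[C1 C2]; have t01 : 0 <= C - 1 <= 1 by apply/andP; split; lra.
  exists (bent ((C - 1) * (3 - (C - 1)) / (1 + (C - 1)))).
  split; last by rewrite Cf_bent// addrC subrK.
  apply: F12_bent; apply/andP; split.
    by rewrite divr_ge0 ?mulr_ge0//; lra.
  rewrite ler_pdivrMr; last by lra.
  by rewrite mul1r -subr_ge0 (_ : _ - _ = (2 - C) ^+ 2) ?sqr_ge0//; ring.
split.
- by move=> f n Ff n2 d T P S; exact: bound.
- move=> f n Ff n2; have [F12f fn0] := Ff.
  have lb : lbound (independent_constants f n) (Cf f).
    by move=> C; exact: Cf_le_independent_constants.
  have sub := @v_martingale_constants_sub _ f n.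
  split; split=> //; first exact: bound.
    by move=> C /sub; exact: lb.
  exact/sub/bound.
- by move=> f [Ff fn0]; rewrite Cf_ge1// Cf_le2.
- split=> // [a aC|b bC].
    by have [|f [Ff <-]] := attained 1; [lra|exact: aC].
  by have [|f [Ff <-]] := attained 2; [lra|exact: bC].
Qed.
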